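(* Let $\mathcal{C}=\{0,1\}^{\mathbb N}$ be the Cantor set, let $d>0$ be an integer, and let $E\subset \mathcal{C}\times\mathcal{C}$ be a proper Cantor graph of vertex degree bound $d$. Then $E$ can be properly colored by $d+1$ colors in a continuous way; that is, there exists a partition of $\mathcal{C}$ into $d+1$ clopen sets $A_1,A_2,\dots,A_{d+1}$ such that if $x\in A_i$, $(x,y)\in E$ and $y\neq x$, then $y\notin A_i$.
   Context: A Borel graph on a standard Borel space $X$ is a Borel subset $E\subset X\times X$ such that $(x,y)\in E$ implies $(y,x)\in E$, and such that $(x,x)\in E$ implies $(x,y)\notin E$ for every $y\neq x$ (no genuine loops; a pair $(x,x)\in E$ only marks $x$ as a singleton component). It has vertex degree bound $d$ if $|\{y\in X : (x,y)\in E\}|\le d$ for every $x\in X$. A Cantor graph is a Borel graph $E\subset\mathcal{C}\times\mathcal{C}$ of bounded vertex degree, where $\mathcal{C}=\{0,1\}^{\mathbb N}$, such that $E$ is a closed subset of $\mathcal{C}\times\mathcal{C}$. For $x,y\in\mathcal{C}$, $d_E(x,y)$ is the shortest path distance of $x$ and $y$ in $E$ if they are in the same connected component, and $\infty$ otherwise. For $x\in\mathcal{C}$ and a positive integer $t$, $(x)_t\in\{0,1\}^{[t]}$, $[t]=\{1,\dots,t\}$, is the projection of $x$ onto its first $t$ coordinates. A Cantor graph $E$ is proper if for any $r>1$ there exists $s_r>1$ such that if $0<d_E(x,y)\le r$, then $(x)_{s_r}\ne (y)_{s_r}$. The sets $A_i$ of the partition may be empty. *)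

(* Defs.v *)
From HB Require Import structures.
From mathcomp Require Import all_boot all_order all_algebra.
From mathcomp Require Import all_classical all_reals all_analysis.

Set Implicit Arguments.
Unset Strict Implicit.
Unset Printing Implicit Defensive.

Import Order.TTheory GRing.Theory Num.Theory.

Local Open Scope classical_set_scope.

Definition borel_set (T : topologicalType) : set (set T) :=
  <<s [set U : set T | open U] >>.

(* Loops (x, x) are allowed, but only at vertices with no other neighbor. *)
Definition borel_graph (X : topologicalType) (E : set (X * X)) : Prop :=
  [/\ borel_set E,
      forall x y, E (x, y) -> E (y, x)
    & forall x, E (x, x) -> forall y, y <> x -> ~ E (x, y)].

(* A loop at x counts x itself as one of its neighbors. *)
Definition degree_bound (X : Type) (E : set (X * X)) (d : nat) : Prop :=
  forall x, ([set y | E (x, y)] #<= `I_d)%card.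

Definition cantor_graph (E : set (cantor_space * cantor_space)) : Prop :=
  [/\ borel_graph E, exists d, degree_bound E d & closed E].

Section Distance.
Variables (X : Type) (E : set (X * X)).

Definition adj : rel X := fun x y => (x, y) \in E.

Definition has_walk (x y : X) (n : nat) : Prop :=
  exists p : seq X, [/\ path adj x p, last x p = y & size p = n].

Lemma has_walkb x y : (exists n, has_walk x y n) ->
  exists n, `[< has_walk x y n >].
Proof. by case=> n /asboolP xyn; exists n. Qed.

Definition graph_dist (x y : X) : \bar int :=
  match pselect (exists n, has_walk x y n) with
  | left xy => (Posz (ex_minn (has_walkb xy)))%:E
  | right _ => +oo%E
  end.

End Distance.

(* The coordinates 1, ..., t of the mathematical text are here 0, ..., t - 1. *)
Definition first_coords (x : cantor_space) (t : nat) : {ffun 'I_t -> bool} :=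
  [ffun i : 'I_t => x i].

(* As distances are integers or infinite, integer radii r suffice. *)
Definition proper_graph (E : set (cantor_space * cantor_space)) : Prop :=
  forall r : nat, (1 < r)%N -> exists2 s : nat, (1 < s)%N &
    forall x y, (0 < graph_dist E x y <= (Posz r)%:E)%E ->
      first_coords x s <> first_coords y s.

(* Main.v *)
Require Import Defs.
From mathcomp Require Import all_boot all_order all_algebra.
From mathcomp Require Import all_classical all_reals all_analysis.
From mathcomp Require Import finmap.

Set Implicit Arguments.
Unset Strict Implicit.
Unset Printing Implicit Defensive.

Local Open Scope classical_set_scope.

(* Greedy coloring along a finite partition of the Cantor set into cylinders
   that are independent in E.  When a cylinder is reached, the points having a
   neighbor of color i form a projection of a closed subset of a compact space,
   so the points for which color i is still available form an open set.  By the
   degree bound these d + 1 open sets cover the cylinder, and since the space is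
   zero-dimensional the cover can be refined to a clopen partition. *)

Lemma clopen_bigcup (T : topologicalType) (I : choiceType) (D : set I)
    (F : I -> set T) :
  finite_set D -> (forall i, D i -> clopen (F i)) ->
  clopen (\bigcup_(i in D) F i).
Proof.
move=> finD cF; split; first by apply: bigcup_open => i /cF[].
by apply: closed_bigcup => // i /cF[].
Qed.

(** Each point is kept only in the set of least index containing it; finitely many sets are removed
    each time, so clopenness survives. *)
Lemma clopen_disjointify (T : topologicalType) (n : nat) (D : 'I_n -> set T) :
  (forall i, clopen (D i)) ->
  exists W : 'I_n -> set T,
    [/\ forall i, clopen (W i), forall i, W i `<=` D i,
        trivIset [set: 'I_n] W & \bigcup_i W i = \bigcup_i D i].
Proof.
move=> cD; pose W i := D i `&` ~` \bigcup_(j in [set j : 'I_n | (j < i)%N]) D j.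
have WD i : W i `<=` D i by move=> x [].
exists W; split => //.
(* The first argument of clopenC is a set that its statement ignores. *)
- move=> i; apply: clopenI => //; apply: (clopenC set0).
  by apply: clopen_bigcup => //; exact: finite_finset.
- move=> i j _ _ [x [[Dix nDi] [Djx nDj]]]; apply/val_inj.
  by case: (ltngtP i j) => // ij; [case: nDj; exists i|case: nDi; exists j].
- apply/seteqP; split=> x [i _ ix]; first by exists i => //; exact: WD.
  have [j /asboolP jx jmin] := @arg_minnP _ i (fun j => `[<D j x>])
    (@nat_of_ord n) (introT (asboolP _) ix).
  exists j => //; split=> // -[k /= kj /asboolP/jmin].
  by rewrite leqNgt kj.
Qed.

(** Finitely many clopen neighborhoods, each inside some [V i], cover [B] by compactness; they are
    grouped by [i] and then made disjoint. *)
Lemma clopen_refinement (T : ptopologicalType) (n : nat) (B : set T)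
    (V : 'I_n -> set T) :
  hausdorff_space T -> zero_dimensional T -> compact [set: T] ->
  clopen B -> (forall i, open (V i)) -> B `<=` \bigcup_i V i ->
  exists W : 'I_n -> set T,
    [/\ forall i, clopen (W i), forall i, W i `<=` V i,
        trivIset [set: 'I_n] W & \bigcup_i W i = B].
Proof.
move=> hT zT cT cB oV BV.
(* The [option] supplies a default index outside [B], as ['I_n] may be empty. *)
have /choice[f fP] x : exists Ui : set T * option 'I_n, B x ->
    [/\ clopen Ui.1, Ui.1 x & exists2 i, Ui.2 = Some i & Ui.1 `<=` V i].
  have [Bx|nBx] := pselect (B x); last by exists (set0, None).
  have [i _ Vix] := BV _ Bx.
  have [U [Ux cU] UV] := zero_dimensional_cvg hT zT cT
    (open_nbhs_nbhs (conj (oV i) Vix)).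
  by exists (U, Some i) => _; split => //; exists i.
have : compact B by apply: subclosed_compact cT _; case: cB.
rewrite compact_cover => /(_ T B (fun x => (f x).1)) [].
- by move=> x /fP[[]].
- by move=> x Bx; exists x => //; case: (fP _ Bx).
move=> D DB BD.
(* The chosen neighborhoods may leave [B], hence the intersection with [B]. *)
pose F i := \bigcup_(x in [set` D] `&` [set x | (f x).2 = Some i])
  (B `&` (f x).1).
have cF i : clopen (F i).
  apply: clopen_bigcup; first exact: finite_setIl.
  by move=> x [/= /DB/set_mem/fP[cf _ _] _]; exact: clopenI.
have [W [cW WF tW UW]] := clopen_disjointify cF.
exists W; split => //.
- move=> i y /WF [x [/= /DB/set_mem/fP[_ _ [j -> fV]] [<-]] [_]].
  exact: fV.
- rewrite UW; apply/seteqP; split=> y; first by move=> [i _ [x _ []]].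
  move=> By; have [x Dx fxy] := BD _ By.
  have /fP[_ _ [i fxi _]] : B x by exact/set_mem/DB.
  by exists i => //; exists x.
Qed.

Lemma closed_neighbors (T : topologicalType) (E : set (T * T)) (A : set T) :
  hausdorff_space T -> compact [set: T] -> closed E -> closed A ->
  closed [set x | exists2 y, E (x, y) & A y].
Proof.
move=> hT cT clE clA.
have -> : [set x | exists2 y, E (x, y) & A y] =
    fst @` (E `&` (snd @^-1` A)).
  apply/seteqP; split=> [x [y xy Ay]|_ [[x y] [xy Ay] <-]]; last by exists y.
  by exists (x, y).
apply: compact_closed => //; apply: continuous_compact.
  by apply: continuous_subspaceT => z; exact: cvg_fst.
apply: (@subclosed_compact _ _ [set: T * T]) => //.
  apply: closedI => //; apply: preimage_closed => //.
  by move=> z _; exact: cvg_snd.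
have -> : [set: T * T] = [set: T] `*` [set: T] by rewrite setXTT.
exact: compact_setX.
Qed.

(** If every color occurred next to [x], choosing one neighbor per color would inject [d.+1] colors
    into the neighbors of [x], since color classes are disjoint. *)
Lemma available_color (T : Type) (E : set (T * T)) (d : nat)
    (A : 'I_d.+1 -> set T) (x : T) :
  degree_bound E d -> trivIset [set: 'I_d.+1] A ->
  exists i, ~ exists2 y, E (x, y) & A i y.
Proof.
move=> dE tA; apply: contrapT => /forallNP nx.
have /choice[f fP] i : exists y, E (x, y) /\ A i y.
  by have /contrapT[y] := nx i; exists y.
have finj : {in [set: 'I_d.+1] &, injective f}.
  move=> i j _ _ fij; apply: tA => //; exists (f i); split.
    by case: (fP i).
  by rewrite fij; case: (fP j).
have : (`I_d.+1 #<= `I_d)%card.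
  rewrite (card_le_eql card_II) -(card_le_eql (inj_card_eq finj)).
  apply: card_le_trans (dE x); apply: subset_card_le.
  by move=> _ [i _ <-]; case: (fP i).
by rewrite card_le_II ltnn.
Qed.

(** Induction on the list of pieces still to be colored; the pieces [B k] may overlap. *)
Lemma clopen_coloring (T : ptopologicalType) (E : set (T * T)) (d : nat)
    (I : eqType) (B : I -> set T) (s : seq I) :
  hausdorff_space T -> zero_dimensional T -> compact [set: T] ->
  closed E -> (forall x y, E (x, y) -> E (y, x)) -> degree_bound E d ->
  (forall k, clopen (B k)) ->
  (forall k x y, B k x -> B k y -> E (x, y) -> y = x) ->
  exists A : 'I_d.+1 -> set T,
    [/\ forall i, clopen (A i),
        trivIset [set: 'I_d.+1] A,
        \bigcup_i A i = \bigcup_(k in [set` s]) B k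
      & forall i x y, A i x -> E (x, y) -> y <> x -> ~ A i y].
Proof.
move=> hT zT cT clE symE dE cB indB.
elim: s => [|k s [A [cA tA UA pA]]].
  exists (fun=> set0); split => //.
  - by move=> ?; exact: clopen0.
  - by move=> i j _ _ [x []].
  - by rewrite set_nil bigcup_set0 bigcup0.
(* Only uncolored points of [B k] receive a color, so earlier choices are never revised. *)
pose C := B k `\` \bigcup_i A i.
pose V i := ~` [set x | exists2 y, E (x, y) & A i y].
have cC : clopen C.
  apply: clopenI => //; apply: (clopenC set0).
  by apply: clopen_bigcup => //; exact: finite_finset.
have oV i : open (V i).
  by apply: closed_openC; apply: closed_neighbors => //; case: (cA i).
have CV : C `<=` \bigcup_i V i.
  by move=> x _; have [i] := available_color x dE tA; exists i.
have [W [cW WV tW UW]] := clopen_refinement hT zT cT cC oV CV.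
have WC i : W i `<=` C by rewrite -UW; exact: bigcup_sup.
have WA i j x : W i x -> ~ A j x by move=> /WC[_ nA] Ax; apply: nA; exists j.
exists (fun i => A i `|` W i); split.
- by move=> i; exact: clopenU.
- move=> i j _ _ [x [[Ai|Wi] [Aj|Wj]]].
  + by apply: tA => //; exists x.
  + by case: (WA _ _ _ Wj Ai).
  + by case: (WA _ _ _ Wi Aj).
  + by apply: tW => //; exists x.
- have -> : [set` k :: s] = k |` [set` s].
    by apply/seteqP; split=> j /=; rewrite inE => /predU1P.
  by rewrite bigcupU UW /C setUDr setDv setD0 UA bigcup_setU1 setUC.
(* Two old points are handled by induction, an old and a new one by the choice of [V i], two new
   ones by the independence of [B k]. *)
- move=> i x y [Ax|Wx] xy yx [Ay|Wy].
  + exact: pA Ax xy yx Ay.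
  + by apply: (WV _ _ Wy); exists x => //; exact: symE.
  + by apply: (WV _ _ Wx); exists y.
  + by apply: yx; apply: (indB k) xy; [case: (WC _ _ Wx)|case: (WC _ _ Wy)].
Qed.

Lemma clopen_cylinder (s : nat) (u : {ffun 'I_s -> bool}) :
  clopen [set x : cantor_space | first_coords x s = u].
Proof.
have -> : [set x : cantor_space | first_coords x s = u] =
    ~` \bigcup_(i : 'I_s) [set x : cantor_space | x i <> u i].
  apply/seteqP; split=> x /=; first by move=> <- [i _]; rewrite /= ffunE.
  move=> xu; apply/ffunP => i; rewrite ffunE; apply: contrapT => xi.
  by apply: xu; exists i.
apply: (clopenC set0).
apply: clopen_bigcup => [|i _]; first exact: finite_finset.
apply: (@preimage_clopen _ _ (fun x : cantor_space => x i) [set b | b <> u i]).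
  by split; [exact: discrete_open|exact: discrete_closed].
exact: proj_continuous.
Qed.

Lemma graph_dist_edge (X : Type) (E : set (X * X)) (x y : X) :
  E (x, y) -> y <> x -> graph_dist E x y = (Posz 1)%:E.
Proof.
move=> xy yx; rewrite /graph_dist; case: pselect => [w|]; last first.
  by case; exists 1%N, [:: y]; split => //=; rewrite andbT; exact/mem_set.
congr (Posz _)%:E; case: ex_minnP => m /asboolP[p [_ pl pm]] mmin.
apply/eqP; rewrite eqn_leq; apply/andP; split.
  apply: mmin; apply/asboolP; exists [:: y]; split => //=.
  by rewrite andbT; exact/mem_set.
(* A walk of length 0 would force [y = x]. *)
by rewrite -pm; case: p pl {pm} => //= /esym.
Qed.

Theorem proposition3 (d : nat) (E : set (cantor_space * cantor_space)) :
  (0 < d)%N ->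
  cantor_graph E ->
  proper_graph E ->
  degree_bound E d ->
  exists A : 'I_d.+1 -> set cantor_space,
    [/\ forall i, clopen (A i),
        trivIset [set: 'I_d.+1] A,
        \bigcup_i A i = [set: cantor_space]
      & forall i x y, A i x -> E (x, y) -> y <> x -> ~ A i y].
Proof.
(* Radius 2 is the least one that [proper_graph] admits; it is applied to points at distance 1,
   making cylinders of length [s] independent. *)
move=> _ [[_ symE _] _ clE] /(_ 2%N isT)[s _ sepE] dE.
pose B u := [set x : cantor_space | first_coords x s = u].
have indB u x y : B u x -> B u y -> E (x, y) -> y = x.
  move=> ux uy xy; apply: contrapT => yx.
  apply: (sepE x y); last by rewrite ux uy.
  by rewrite graph_dist_edge.
(* All words of length [s] are listed, so the cylinders cover the whole space. *)
have [A [cA tA UA pA]] := clopen_coloring (enum {: {ffun 'I_s -> bool}})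
  cantor_space_hausdorff cantor_zero_dimensional cantor_space_compact
  clE symE dE (@clopen_cylinder s) indB.
exists A; split => //; rewrite UA; apply/seteqP; split=> // x _.
by exists (first_coords x s) => //=; rewrite mem_enum.
Qed.
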